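(* For each finite ordered alphabet $\mathbb A$ and each symmetric cyclic Abelian class $\mathfrak X$ over $\mathbb A$ we have $|\mathcal U_{alt}(\mathfrak X)|=1$. In particular, if $\mathbb A\subseteq\{2,3,4,\ldots\}$ (with the usual order), then each cyclic Abelian class $\mathcal C$ over $\mathbb A$ contains a unique (up to reversal) cyclic word $\omega$ with the property that $K^{\circlearrowright}(\omega)=\max\{K^{\circlearrowright}(\nu):\nu\in\mathcal C\}$.
   Context: Words: $\mathbb A^+$ (resp. $\mathbb A^*$) is the set of non-empty (resp. all) finite words over the finite non-empty totally ordered alphabet $\mathbb A$. For $x=x_1\cdots x_n$ put $x^*=x_n\cdots x_1$. A cyclic word over $\mathbb A$ is an equivalence class of $\mathbb A^+$ under $w\sim w'$ iff $w=pq$, $w'=qp$ for some $p,q\in\mathbb A^*$. ''$\omega=uv$'' means that $uv$ belongs to the class $\omega$. The reversal $\omega^*$ is the class of $x^*$ for any $x$ in $\omega$, and $\bar\omega=\{\omega,\omega^*\}$. A cyclic Abelian class $\mathcal C$ is the set of all cyclic words over $\mathbb A$ having a prescribed non-zero Parikh vector (number of occurrences of each letter); the corresponding symmetric cyclic Abelian class is $\mathfrak X=\{\bar\omega:\omega\in\mathcal C\}$. Alternating order (for words of equal length): if $x\ne y$ have equal length and $i$ is the first (1-based) index with $x_i\neq y_i$, then $x\prec_{alt}y$ iff ($i$ odd and $x_i<y_i$) or ($i$ even and $x_i>y_i$). A factorization $\omega=uv$ with $u,v\in\mathbb A^+$, $u\neq u^*$, $v\neq v^*$ is alt-synchronizing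 if ($u\prec_{alt}u^*\iff v\prec_{alt}v^*$). $\mathcal U_{alt}(\mathcal C)$ is the set of $\omega\in\mathcal C$ such that no factorization $\omega=uv$ with $u\neq u^*$, $v\neq v^*$ is alt-synchronizing, and $\mathcal U_{alt}(\mathfrak X)=\{\bar\omega:\omega\in\mathcal U_{alt}(\mathcal C)\}$. Regular continuant: $K()=1$, $K(x_1)=x_1$, $K(x_1\cdots x_n)=x_nK(x_1\cdots x_{n-1})+K(x_1\cdots x_{n-2})$. Cyclic version: $K^{\circlearrowright}(x_1\cdots x_n)=K(x_1\cdots x_n)+K(x_2\cdots x_{n-1})$ for $n\ge2$ (for $n=1$ it is taken to be $x_1$). It is invariant under cyclic conjugation, hence well defined on cyclic words. *)

(* Defs.v *)
From mathcomp Require Import all_boot all_order finmap.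
From mathcomp.classical Require Import boolp classical_sets functions.
From mathcomp.classical Require Import cardinality.

Set Implicit Arguments.
Unset Strict Implicit.
Unset Printing Implicit Defensive.

Import Order.TTheory.
Local Open Scope quotient_scope.
Local Open Scope classical_set_scope.

Section CyclicWords.
Variable A : finType.
Implicit Types (x y u v : seq A) (p : {ffun A -> nat}).

Definition word : Type := {x : seq A | x != [::]}.
Implicit Types w : word.

Lemma wcat_subproof w1 w2 : val w1 ++ val w2 != [::].
Proof. by case: w1 => -[]. Qed.

Definition wcat w1 w2 : word := Sub (val w1 ++ val w2) (wcat_subproof w1 w2).

Lemma wrev_subproof w : rev (val w) != [::].
Proof. by rewrite -size_eq0 size_rev size_eq0 (valP w). Qed.

Definition wrev w : word := Sub (rev (val w)) (wrev_subproof w).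

Definition conjugate : rel word :=
  fun w1 w2 => `[< exists u v, val w1 = u ++ v /\ val w2 = v ++ u >].

Lemma conjugateP w1 w2 :
  reflect (exists n, val w2 = rot n (val w1)) (conjugate w1 w2).
Proof.
apply: (iffP (asboolP _)) => [[u [v [-> ->]]]|[n ->]].
  by exists (size u); rewrite rot_size_cat.
by exists (take n (val w1)), (drop n (val w1)); rewrite cat_take_drop.
Qed.

Lemma conjugate_refl : reflexive conjugate.
Proof. by move=> w; apply/conjugateP; exists 0; rewrite rot0. Qed.

Lemma conjugate_sym : symmetric conjugate.
Proof.
by move=> w1 w2; apply: asbool_equiv_eq; split=> -[u [v [e1 e2]]];
   exists v, u.
Qed.

Lemma conjugate_trans : transitive conjugate.
Proof.
move=> w2 w1 w3 /conjugateP [m e2] /conjugateP [n e3]; apply/conjugateP.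
move: e3; rewrite e2; case: (leqP m (size (val w1))) => [lem|/ltnW gem].
  case: (leqP n (size (val w1))) => [len|/ltnW gen] e3.
    move: e3; rewrite rot_add_mod // => ->; by eexists.
  by exists m; rewrite e3 rot_oversize // size_rot.
by rewrite (rot_oversize gem) => e3; exists n.
Qed.

Canonical conjugate_equiv :=
  EquivRel conjugate conjugate_refl conjugate_sym conjugate_trans.

Definition cyclic_word : Type := {eq_quot conjugate_equiv}.
Implicit Types om : cyclic_word.

Definition crev : cyclic_word -> cyclic_word := lift_op1 cyclic_word wrev.

Lemma pi_crev : {morph \pi_cyclic_word : w / wrev w >-> crev w}.
Proof.
move=> w; unlock crev; apply/eqmodP/asboolP.
have /eqmodP/asboolP [u [v [e1 e2]]] :
    w = repr (\pi_cyclic_word w) %[mod cyclic_word].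
  by rewrite reprK.
by exists (rev v), (rev u); rewrite /= e1 e2 !rev_cat.
Qed.
Canonical pi_crev_morph := PiMorph1 pi_crev.

Definition symm om : set cyclic_word := [set om; crev om].

Definition parikh x : {ffun A -> nat} := [ffun a => count_mem a x].

Definition cparikh : cyclic_word -> {ffun A -> nat} :=
  lift_fun1 cyclic_word (fun w => parikh (val w)).

Lemma pi_cparikh : {mono \pi_cyclic_word : w / parikh (val w) >-> cparikh w}.
Proof.
move=> w; unlock cparikh.
have /eqmodP/asboolP [u [v [-> ->]]] :
    w = repr (\pi_cyclic_word w) %[mod cyclic_word].
  by rewrite reprK.
by apply/ffunP => a; rewrite !ffunE !count_cat addnC.
Qed.
Canonical pi_cparikh_morph := PiMono1 pi_cparikh.

Definition cyclic_abelian_class p : set cyclic_word :=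
  [set om | cparikh om = p].

Definition symmetric_cyclic_abelian_class p : set (set cyclic_word) :=
  symm @` cyclic_abelian_class p.

End CyclicWords.

Arguments cyclic_word A : clear implicits.
Arguments word A : clear implicits.

Section AlternatingOrder.
Variables (disp : Order.disp_t) (A : finOrderType disp).
Local Open Scope order_scope.

(* The first difference sits at the 1-based index [(size s).+1], which is odd
   exactly when [size s] is even. *)
Definition alt_lt (x y : seq A) : Prop :=
  size x = size y /\
  exists s a b x' y',
    [/\ x = s ++ a :: x', y = s ++ b :: y', a != b
      & if odd (size s) then b < a else a < b].

Definition alt_synchronizing (u v : seq A) : Prop :=
  alt_lt u (rev u) <-> alt_lt v (rev v).

Definition Ualt (C : set (cyclic_word A)) : set (cyclic_word A) :=
  [set om | C om /\
    forall u v : word A, om = \pi_(cyclic_word A) (wcat u v) ->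
      val u != rev (val u) -> val v != rev (val v) ->
      ~ alt_synchronizing (val u) (val v)].

(* A symmetric class is closed under reversal, so the cyclic Abelian class it
   comes from is the union of its members (see [bigcup_symmetric_class]). *)
Definition Ualt_sym (X : set (set (cyclic_word A))) :
    set (set (cyclic_word A)) :=
  @symm A @` Ualt (\bigcup_(o in X) o).

End AlternatingOrder.

Lemma crev_class (A : finType) (p : {ffun A -> nat}) (om : cyclic_word A) :
  cyclic_abelian_class p om -> cyclic_abelian_class p (crev om).
Proof.
rewrite /cyclic_abelian_class /=; elim/quotW: om => w; rewrite !piE => <-.
by apply/ffunP => a; rewrite !ffunE count_rev.
Qed.

Lemma bigcup_symmetric_class (A : finType) (p : {ffun A -> nat}) :
  \bigcup_(o in symmetric_cyclic_abelian_class p) o = cyclic_abelian_class p.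
Proof.
apply/seteqP; split => [om [_ [nu Cnu <-]] [->|->] //|om Com].
  exact: crev_class.
by exists (symm om); [exists om | left].
Qed.

Fixpoint continuant_rev (s : seq nat) : nat :=
  match s with
  | [::] => 1
  | x :: s1 =>
      match s1 with
      | [::] => x
      | _ :: s2 => x * continuant_rev s1 + continuant_rev s2
      end
  end.

(* The recursion removes letters from the right. *)
Definition continuant (s : seq nat) : nat := continuant_rev (rev s).

Lemma continuant0 : continuant [::] = 1. Proof. by []. Qed.

Lemma continuant1 x : continuant [:: x] = x. Proof. by []. Qed.

Lemma continuant_rcons s y x :
  continuant (rcons (rcons s y) x) =
  x * continuant (rcons s y) + continuant s.
Proof. by rewrite /continuant !rev_rcons. Qed.

Lemma continuant_cons x y s :
  continuant (x :: y :: s) = x * continuant (y :: s) + continuant s.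
Proof.
have [n] := ubnP (size s); elim: n y s => // n IH y s.
case/lastP: s => [_|s a]; first by rewrite (continuant_rcons [::] x y) mulnC.
rewrite size_rcons ltnS; case/lastP: s => [_|s b].
  rewrite (continuant_rcons [:: x] y a) (continuant_rcons [::] y a) /=.
  rewrite (continuant_rcons [::] x y) continuant0 !continuant1.
  by rewrite !mulnDr !muln1 addnAC [x * (a * y)]mulnC -mulnA.
rewrite size_rcons => sn.
have Kxy := continuant_rcons (x :: y :: s) b a.
have Ky := continuant_rcons (y :: s) b a.
rewrite !rcons_cons in Kxy Ky *; rewrite Kxy Ky continuant_rcons.
rewrite !IH ?size_rcons //; last exact: ltnW.
by rewrite !mulnDr mulnCA addnACA.
Qed.

(* [x_2 ... x_(n-1)] is [take (n - 2)] of the tail. *)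
Definition cyclic_continuant_word (s : seq nat) : nat :=
  match s with
  | [:: x] => x
  | _ => continuant s + continuant (take (size s - 2) (behead s))
  end.

Lemma cyclic_continuant_rot1 s :
  cyclic_continuant_word (rot 1 s) = cyclic_continuant_word s.
Proof.
case: s => [|x [|y s]] //; rewrite rot1_cons.
have E t : 1 < size t -> cyclic_continuant_word t =
  continuant t + continuant (take (size t - 2) (behead t)).
  by case: t => [|? [|? ?]].
rewrite !E ?size_rcons //=.
case/lastP: s y => [|s z] y.
  by rewrite (continuant_rcons [::] y x) (continuant_rcons [::] x y) mulnC.
have take_rcons (t : seq nat) a : take (size t) (rcons t a) = t.
  by rewrite -cats1 take_size_cat.
rewrite -rcons_cons -rcons_cons continuant_rcons rcons_cons continuant_cons.
have -> : (size (rcons s z)).+2 - 2 = size (rcons s z).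
  by rewrite !subSS subn0.
rewrite take_rcons size_rcons -[X in take X _]/(size (y :: s)).
by rewrite -rcons_cons take_rcons addnAC.
Qed.

Lemma cyclic_continuant_rot n s :
  cyclic_continuant_word (rot n s) = cyclic_continuant_word s.
Proof.
case: (leqP n (size s)) => [|/ltnW le_sn]; last by rewrite rot_oversize.
elim: n => [|n IH] lt_ns; first by rewrite rot0.
by rewrite -addn1 addnC rotD ?add1n // cyclic_continuant_rot1 IH // ltnW.
Qed.

Section CyclicContinuant.
Local Open Scope fset_scope.
Variable A : {fset nat}.

Definition cyclic_continuant : cyclic_word A -> nat :=
  lift_fun1 (cyclic_word A)
    (fun w => cyclic_continuant_word [seq fsval a | a <- val w]).

Lemma pi_cyclic_continuant :
  {mono \pi_(cyclic_word A) : w /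
    cyclic_continuant_word [seq fsval a | a <- val w]
      >-> cyclic_continuant w}.
Proof.
move=> w; unlock cyclic_continuant.
have /eqmodP/conjugateP [n ->] :
    w = repr (\pi_(cyclic_word A) w) %[mod cyclic_word A].
  by rewrite reprK.
by rewrite map_rot cyclic_continuant_rot.
Qed.
Canonical pi_cyclic_continuant_morph := PiMono1 pi_cyclic_continuant.

End CyclicContinuant.

(* Main.v *)
Require Import Defs.
From mathcomp Require Import all_boot all_order finmap.
From mathcomp.classical Require Import boolp classical_sets functions cardinality.
From mathcomp Require Import zify.

Set Implicit Arguments.
Unset Strict Implicit.
Unset Printing Implicit Defensive.

(* Uniqueness: cut a word of U_alt as [s t] with every letter of [s] at most
   every letter of [t], and let [m] be the least letter of [t].  Unless [t]
   begins or ends with [m], cutting just before the first [m] of [t] gives a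
   synchronizing factorization.  If [s <> s^*], the comparison of [s] with [s^*]
   dictates that of [t] with [t^*], hence at which end of [t] the letter [m]
   sits; if [s = s^*], the choice of the end only amounts to a reversal.  Thus
   the word is grown letter by letter, in a forced way, from its least letter.

   Existence and maximality: embed the alphabet in {2, 3, ...}.  A continued
   fraction with these partial quotients is monotone for the alternating order,
   and the cyclic continuant is the trace of a product of 2x2 matrices, so
   reversing one factor of a synchronizing factorization increases it.  A
   maximizer of the cyclic continuant therefore lies in U_alt. *)

(** * Words up to rotation and reversal *)

Section Dihedral.
Variable T : eqType.
Implicit Types w : seq T.

Lemma rot_rot_ex m n w : exists k, rot m (rot n w) = rot k w.
Proof. by rewrite rot_rot_add; eexists. Qed.

Lemma rev_rot_ex n w : exists k, rev (rot n w) = rot k (rev w).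
Proof. by rewrite rev_rot; eexists. Qed.

Definition dihedral w1 w2 :=
  exists n, w2 = rot n w1 \/ w2 = rot n (rev w1).

Lemma dihedral_rot n w : dihedral w (rot n w).
Proof. by exists n; left. Qed.

Lemma dihedral_rev w : dihedral w (rev w).
Proof. by exists 0; right; rewrite rot0. Qed.

Lemma dihedral_trans w2 w1 w3 :
  dihedral w1 w2 -> dihedral w2 w3 -> dihedral w1 w3.
Proof.
move=> [n e2] [m [->|->]]; case: e2 => ->.
- by have [k ->] := rot_rot_ex m n w1; exists k; left.
- by have [k ->] := rot_rot_ex m n (rev w1); exists k; right.
- have [k ->] := rev_rot_ex n w1; have [l ->] := rot_rot_ex m k (rev w1).
  by exists l; right.
- have [k ->] := rev_rot_ex n (rev w1); rewrite revK.
  by have [l ->] := rot_rot_ex m k w1; exists l; left.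
Qed.

Lemma dihedral_sym w1 w2 : dihedral w1 w2 -> dihedral w2 w1.
Proof.
move=> [n [->|->]].
  by exists (size (rot n w1) - n); left; rewrite -[LHS](rotK n).
have [k e] := rev_rot_ex n (rev w1); rewrite revK in e.
by exists (size (rot k w1) - k); right; rewrite e -[LHS](rotK k).
Qed.

End Dihedral.

(** * The alternating order on words of natural numbers *)

(** The flag [up] tells whether the current index is odd, that is, whether letters are compared in
    the usual order. *)
Fixpoint altcmp (up : bool) (s t : seq nat) : bool :=
  match s, t with
  | x :: s', y :: t' =>
      (if up then x < y else y < x) || ((x == y) && altcmp (~~ up) s' t')
  | _, _ => false
  end.

Definition altlt := altcmp true.

Lemma altcmpNC up s t : altcmp (~~ up) s t = altcmp up t s.
Proof.
elim: s t up => [|x s IH] [|y t] up //=.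
by rewrite -IH eq_sym; case: up.
Qed.

(** Swapping the arguments replaces flipping the flag, so that inductions on [altlt] need not track
    parity. *)
Lemma altlt_cons x y s t :
  altlt (x :: s) (y :: t) = (x < y) || ((x == y) && altlt t s).
Proof. by rewrite /altlt -(altcmpNC true s). Qed.

Lemma altltxx s : altlt s s = false.
Proof. by elim: s => // x s IH; rewrite altlt_cons ltnn eqxx. Qed.

Lemma altltN s t : size s = size t -> s != t -> altlt t s = ~~ altlt s t.
Proof.
elim: s t => [|x s IH] [|y t] // [sz].
rewrite eqseq_cons negb_and !altlt_cons; case: (ltngtP x y) => //= _ ne.
by rewrite IH ?negbK.
Qed.

Lemma altlt_rev_cons_rcons x y s :
  altlt (x :: rcons s y) (rev (x :: rcons s y)) -> x <= y.
Proof.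
by rewrite rev_cons rev_rcons rcons_cons altlt_cons => /orP[/ltnW|/andP[/eqP->]].
Qed.

Lemma ltn_altlt_rev x y s :
  x < y -> altlt (x :: rcons s y) (rev (x :: rcons s y)).
Proof. by rewrite rev_cons rev_rcons rcons_cons altlt_cons => ->. Qed.

Lemma ltn_neq_rev x y s : x < y -> x :: rcons s y != rev (x :: rcons s y).
Proof.
move=> xy; rewrite rev_cons rev_rcons rcons_cons; apply/eqP => -[e _].
by rewrite e ltnn in xy.
Qed.

(** * Words without synchronizing factorization: uniqueness up to rotation and reversal *)

(** Letting [n] vary yields all factorizations of the cyclic word of [w]. Empty factors are
    palindromes, hence excluded. *)
Definition unsync (w : seq nat) :=
  forall n u v, rot n w = u ++ v -> u != rev u -> v != rev v ->
    altlt u (rev u) != altlt v (rev v).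

Lemma unsync_rot n w : unsync w -> unsync (rot n w).
Proof. by move=> Uw m; have [k ->] := rot_rot_ex m n w; apply: Uw. Qed.

Lemma neq_revC (u : seq nat) : (rev u != u) = (u != rev u).
Proof. by rewrite eq_sym. Qed.

(** Reversing [w] reverses both factors, which negates both comparisons, so they still differ. *)
Lemma unsync_rev w : unsync w -> unsync (rev w).
Proof.
move=> Uw n u v e pu pv.
have [k ek] := rev_rot_ex n (rev w); rewrite revK e rev_cat in ek.
have := Uw k _ _ (esym ek); rewrite !revK !neq_revC => /(_ pv pu).
rewrite (altltN _ pu) ?size_rev // (altltN _ pv) ?size_rev //.
by case: altlt; case: altlt.
Qed.

Lemma first_occurrence (T : eqType) (m : T) t : m \in t ->
  exists t1 t2, t = t1 ++ m :: t2 /\ m \notin t1.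
Proof.
elim: t => // a t IH; rewrite inE; case: (eqVneq m a) => [<- _|ma /= /IH].
  by exists [::], t.
by move=> [t1 [t2 [-> mt1]]]; exists (a :: t1), t2; rewrite inE negb_or ma.
Qed.

(** Otherwise cut before the first [m] of [t]: the factors have end letters [x < y] and [m < z], so
    both precede their reversals. *)
Lemma min_adjacent x s t m :
  unsync (x :: s ++ t) -> x <= m -> m \in t -> {in t, forall a, m <= a} ->
  (exists t', t = m :: t') \/ (exists t', t = rcons t' m).
Proof.
move=> Uw xm mt mint; have [t1 [t2 [et mt1]]] := first_occurrence mt.
case/lastP: t1 et mt1 => [|t1 y] et mt1; first by left; exists t2.
case/lastP: t2 et => [|t2 z] et.
  by right; exists (rcons t1 y); rewrite et cats1.
case: (eqVneq m z) => [mz|mz].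
  by right; exists (rcons t1 y ++ m :: t2); rewrite et rcons_cat mz.
have ltmz : m < z.
  by rewrite ltn_neqAle mz mint // et !(mem_cat, inE, mem_rcons) eqxx !orbT.
have ltmy : m < y.
  rewrite ltn_neqAle mint ?et ?mem_cat ?mem_rcons ?inE ?eqxx // andbT.
  by apply: contraNneq mt1 => ->; rewrite mem_rcons inE eqxx.
have ltxy := leq_ltn_trans xm ltmy.
have e : rot 0 (x :: s ++ t) = (x :: rcons (s ++ t1) y) ++ m :: rcons t2 z.
  by rewrite rot0 et /= -!cats1 -!catA.
have := Uw _ _ _ e (ltn_neq_rev _ ltxy) (ltn_neq_rev _ ltmz).
by rewrite !ltn_altlt_rev.
Qed.

(** The forced construction: the letters of [L] are attached one by one, on the side dictated by
    comparing [s] with its reversal. For a palindrome the right side is a convention. *)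
Fixpoint grow (s L : seq nat) : seq nat :=
  if L is m :: L' then
    if altlt s (rev s) then grow (m :: s) L' else grow (rcons s m) L'
  else s.

(** Induction on [L]: its head [m], the least letter of [t], is moved from an end of [t] to the
    adjacent end of [s] in the cyclic word. *)
Lemma unsync_grow L s t :
  s != [::] -> sorted leq L -> perm_eq t L -> allrel leq s L ->
  unsync (s ++ t) -> dihedral (s ++ t) (grow s L).
Proof.
elim: L s t => [|m L IH] s t s0 Lsort.
  by move=> /perm_nilP -> _ _; rewrite cats0; exists 0; left; rewrite rot0.
move=> ptL sL Ust.
have Lsort' : sorted leq L := path_sorted Lsort.
have minL : {in L, forall a, m <= a}.
  move=> a aL; move: Lsort.
  by rewrite /= (path_sortedE leq_trans) => /andP[/allP/(_ a aL)].
have mint : {in t, forall a, m <= a}.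
  move=> a; rewrite (perm_mem ptL) inE => /orP[/eqP->//|]; exact: minL.
have mt : m \in t by rewrite (perm_mem ptL) inE eqxx.
have sm a : a \in s -> a <= m.
  by move=> ins; apply: (allrelP sL) => //; rewrite inE eqxx.
have sL' : allrel leq s L.
  by apply/allrelP => a b ins inL; apply: (allrelP sL); rewrite // inE inL orbT.
have mL : all (leq m) L by apply/allP.
have ends : (exists t', t = m :: t') \/ (exists t', t = rcons t' m).
  case: s s0 sm Ust {sL sL'} => // x s _ sm Ust.
  by apply: (min_adjacent Ust) => //; apply: sm; rewrite inE eqxx.
have grow_left t' : t = rcons t' m -> dihedral (s ++ t) (grow (m :: s) L).
  move=> et; have e : rotr 1 (s ++ t) = (m :: s) ++ t'.
    by rewrite et -rcons_cat rotr1_rcons.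
  apply: (dihedral_trans (dihedral_rot _ _ : dihedral _ (rotr 1 (s ++ t)))).
  rewrite e; apply: IH => //; last by rewrite -e; apply: unsync_rot.
    by move: ptL; rewrite et perm_rcons perm_cons.
  by rewrite allrel_consl mL.
(* Stated for any [w] dihedral to [s ++ m :: t'], since for palindromic [s] the word may first have
   to be reversed. *)
have grow_right w t' : dihedral w (s ++ m :: t') -> unsync (s ++ m :: t') ->
    perm_eq (m :: t') t -> dihedral w (grow (rcons s m) L).
  move=> wt U pt; apply: (dihedral_trans wt); rewrite -cat_rcons.
  apply: IH => //; last by rewrite cat_rcons.
  - by case: (s).
  - by move: (perm_trans pt ptL); rewrite perm_cons.
  - by rewrite -cats1 allrel_catl sL' /= allrel_consl mL.
have diht := dihedral_rot 0 (s ++ t); rewrite rot0 in diht.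
rewrite /=; case: ifPn => slt.
  (* If [t] began with [m] and ended with a larger letter, it would precede its reversal, as [s]
     does. *)
  suff [t' et] : exists t', t = rcons t' m by exact: grow_left et.
  case: ends => // -[t' et]; case/lastP: t' et => [|t' z] et.
    by exists [::].
  case: (eqVneq m z) => [mz|mz]; first by exists (m :: t'); rewrite et mz.
  have ltmz : m < z.
    by rewrite ltn_neqAle mz mint // et !(inE, mem_rcons) eqxx !orbT.
  have := Ust 0 s t; rewrite rot0 slt et ltn_altlt_rev ?ltn_neq_rev //.
  have ns : s != rev s by apply: contraTneq slt => <-; rewrite altltxx.
  by move=> /(_ erefl ns isT).
case: ends => -[t' et]; first by apply: (@grow_right _ t'); rewrite -?et.
case: t' et => [/= et|z t' et].
  by apply: (@grow_right _ [::]); rewrite -?et.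
(* Here [t] ends with [m]. If [s] is a palindrome, the reversal of [s ++ t] is a rotation of
   [s ++ rev t], where [m] follows [s]. *)
case: (eqVneq s (rev s)) => [es|ns].
  have e : dihedral (s ++ t) (s ++ m :: rev (z :: t')).
    have := dihedral_trans (dihedral_rev (s ++ t))
                           (dihedral_rot (size t) (rev (s ++ t))).
    rewrite rev_cat -(size_rev t) rot_size_cat -es et.
    by rewrite rev_rcons.
  apply: (@grow_right _ (rev (z :: t'))) => //; last first.
    by rewrite -rev_rcons -et perm_rev.
  rewrite -rev_rcons -et {1}es -rot_size_cat -rev_cat.
  exact/unsync_rot/unsync_rev.
(* Now [s] follows its reversal. A first letter [z > m] would make [t] follow its own as well. *)
case: (eqVneq m z) => [mz|mz].
  rewrite -mz rcons_cons in et.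
  by apply: (@grow_right _ (rcons t' m)); rewrite -?et.
have ltmz : m < z.
  by rewrite ltn_neqAle mz mint // et !(inE, mem_rcons) eqxx ?orbT.
have := Ust 0 s t; rewrite rot0 (negPf slt) => /(_ erefl ns).
have tlt : altlt t (rev t) = false.
  by apply/negP; rewrite et => /altlt_rev_cons_rcons; rewrite leqNgt ltmz.
rewrite tlt => H; suff /H : t != rev t by [].
by rewrite et; apply: contra_neq mz; rewrite rev_rcons => -[].
Qed.

(** Both words are dihedral to the word grown from their sorted letters, which depends only on the
    multiset of letters. The default [0] of [head] is never reached, as [w] is non-empty. *)
Lemma unsync_unique w1 w2 :
  perm_eq w1 w2 -> unsync w1 -> unsync w2 -> dihedral w1 w2.
Proof.
suff H w : w != [::] -> unsync w ->
    dihedral w (grow [:: head 0 (sort leq w)] (behead (sort leq w))).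
  case: (eqVneq w2 [::]) => [->|n2 p12 U1 U2].
    by move=> /perm_nilP-> _ _; exists 0; left.
  have n1 : w1 != [::] by rewrite -size_eq0 (perm_size p12) size_eq0.
  have /(perm_sortP leq_total leq_trans anti_leq) e := p12.
  by apply: (dihedral_trans (H _ n1 U1)); rewrite e; apply/dihedral_sym/H.
move=> n0 Uw; have := sort_sorted leq_total w.
have := permEl (perm_sort leq w); rewrite perm_sym.
case: (sort leq w) => [/perm_nilP/eqP|m L pw]; first by rewrite (negPf n0).
move=> srt /=; have [i w' ew] : rot_to_spec w m.
  by apply: rot_to; rewrite (perm_mem pw) inE eqxx.
apply: (dihedral_trans (dihedral_rot i w)); rewrite ew -cat1s.
apply: unsync_grow => //.
- exact: path_sorted srt.
- by rewrite -(perm_cons m) -ew perm_rot.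
- by rewrite allrel1l; move: srt; rewrite /= (path_sortedE leq_trans) => /andP[].
- by rewrite cat1s -ew; apply: unsync_rot.
Qed.

(** * Continuants as entries of products of 2x2 matrices, and the effect of reversing a factor *)

Section ContinuantMatrix.
Implicit Types (s t u v w : seq nat) (M N : (nat * nat) * (nat * nat)).

(** A matrix is stored as the pair of its rows. *)
Definition mul2 M N : (nat * nat) * (nat * nat) :=
  let: ((a, b), (c, d)) := M in
  let: ((a', b'), (c', d')) := N in
  ((a * a' + b * c', a * b' + b * d'), (c * a' + d * c', c * b' + d * d')).

Definition tr2 M := let: ((a, b), (c, d)) := M in ((a, c), (b, d)).

Definition trace2 M := M.1.1 + M.2.2.

Lemma mul2A : associative mul2.
Proof.
case=> [[a b] [c d]] [[a' b'] [c' d']] [[x y] [z t]] /=.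
by congr ((_, _), (_, _)); rewrite !mulnDl !mulnDr !mulnA addnACA.
Qed.

Lemma tr2_mul M N : tr2 (mul2 M N) = mul2 (tr2 N) (tr2 M).
Proof.
case: M N => [[a b] [c d]] [[a' b'] [c' d']] /=.
by congr ((_, _), (_, _)); lia.
Qed.

Definition letter_mat (x : nat) := ((x, 1), (1, 0)).

Definition cmat s := foldr (fun x => mul2 (letter_mat x)) ((1, 0), (0, 1)) s.

Lemma cmat_cons x s : cmat (x :: s) = mul2 (letter_mat x) (cmat s).
Proof. by []. Qed.

Lemma cmat_cat s t : cmat (s ++ t) = mul2 (cmat s) (cmat t).
Proof.
elim: s => [|x s IH]; last by rewrite !cmat_cons IH mul2A.
by case: (cmat t) => [[a b] [c d]] /=; rewrite !mul1n !mul0n !add0n !addn0.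
Qed.

(** The letter matrices are symmetric, so transposing their product only reverses its order. *)
Lemma cmat_rev s : cmat (rev s) = tr2 (cmat s).
Proof.
elim: s => // x s IH; rewrite rev_cons -cats1 cmat_cat IH cmat_cons tr2_mul.
by congr mul2; rewrite /cmat /=; congr ((_, _), (_, _)); lia.
Qed.

Lemma cmat_continuant s : (cmat s).1.1 = continuant s.
Proof.
(* The recurrence has depth two, so two consecutive lengths are treated together. *)
suff [] : (cmat s).1.1 = continuant s /\
          forall x, (cmat (x :: s)).1.1 = continuant (x :: s) by [].
elim: s => [|y s [IH1 IH2]]; first by split=> // x; rewrite continuant1 /=; lia.
split=> // x; rewrite continuant_cons -IH1 -IH2 /=.
by case: (cmat s) => [[a b] [c d]] /=; lia.
Qed.

Lemma cmat_cons21 x s : (cmat (x :: s)).2.1 = (cmat s).1.1.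
Proof. by rewrite /=; case: (cmat s) => [[a b] [c d]] /=; lia. Qed.

Lemma cmat_cons22 x s : (cmat (x :: s)).2.2 = (cmat s).1.2.
Proof. by rewrite /=; case: (cmat s) => [[a b] [c d]] /=; lia. Qed.

Lemma cmat_cons11 x s : (cmat (x :: s)).1.1 = x * (cmat s).1.1 + (cmat s).2.1.
Proof. by rewrite /=; case: (cmat s) => [[a b] [c d]] /=; lia. Qed.

Lemma cmat_rev11 s : (cmat (rev s)).1.1 = (cmat s).1.1.
Proof. by rewrite cmat_rev; case: (cmat s) => [[a b] [c d]]. Qed.

Lemma cmat_rev21 s : (cmat (rev s)).2.1 = (cmat s).1.2.
Proof. by rewrite cmat_rev; case: (cmat s) => [[a b] [c d]]. Qed.

(** The lower right entry is the continuant of the inner letters: the second row drops the first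
    letter and, after transposition, the last one. *)
Lemma cyclic_continuant_trace s : cyclic_continuant_word s = trace2 (cmat s).
Proof.
case: s => [|x s] //; case/lastP: s => [|s y].
  by rewrite /trace2 /= /mul2; lia.
rewrite /trace2 cmat_continuant cmat_cons22 -cmat_rev21 rev_rcons cmat_cons21.
rewrite cmat_rev11 cmat_continuant.
have -> : cyclic_continuant_word (x :: rcons s y) =
    continuant (x :: rcons s y) + continuant (take (size s) (rcons s y)).
  by case: s => //= z s; rewrite size_rcons.
by rewrite -cats1 take_size_cat.
Qed.

(** The continued fraction exceeds 1, so what follows a leading letter contributes less than 1. *)
Lemma cmat_lt s : all (leq 2) s -> (cmat s).2.1 < (cmat s).1.1.
Proof.
elim: s => // x s IH /= /andP[x2 /IH]; rewrite -/(cmat (x :: s)).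
rewrite cmat_cons21 cmat_cons11; nia.
Qed.

(* The ratio [(cmat s).1.1 / (cmat s).2.1] is the continued fraction with
   partial quotients [s]. *)
Lemma altlt_cmat s t : size s = size t -> all (leq 2) s -> all (leq 2) t ->
  altlt s t -> (cmat s).1.1 * (cmat t).2.1 < (cmat t).1.1 * (cmat s).2.1.
Proof.
elim: {s}(size s) {-2}s t (erefl (size s)) => [|n IH] [|x s] [|y t] //.
move=> [sn] [st] /andP[x2 s2] /andP[y2 t2]; rewrite altlt_cons.
rewrite !cmat_cons11 !cmat_cons21 => /orP[xy|/andP[/eqP-> ts]].
  (* With tails of values [a/c] and [a'/c']: [x + c/a < x + 1 <= y <= y + c'/a']. *)
  have := cmat_lt s2; have := cmat_lt t2.
  move: (cmat s) (cmat t) => [[a b] [c d]] [[a' b'] [c' d']] /= ca' ca.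
  have : x.+1 * (a * a') <= y * (a * a') by rewrite leq_mul2r xy orbT.
  have : c * a' < a * a' by rewrite ltn_mul2r ca (leq_ltn_trans _ ca').
  lia.
(* Equal first letters: taking reciprocals of the tails reverses the order, which matches the swap
   in [altlt_cons]. *)
have := IH t s; rewrite -sn -st => /(_ erefl erefl t2 s2 ts); nia.
Qed.

(** The matrices of [u] and [rev u] are transposes with equal upper left entry, so comparing the two
    continued fractions amounts to comparing the off-diagonal entries of one matrix. *)
Lemma altlt_rev_cmat u : all (leq 2) u -> u != rev u ->
  if altlt u (rev u) then (cmat u).1.2 < (cmat u).2.1
  else (cmat u).2.1 < (cmat u).1.2.
Proof.
move=> u2 nu; have u2' : all (leq 2) (rev u) by rewrite all_rev.
have szu : size u = size (rev u) by rewrite size_rev.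
case: ifP => ltu.
  have := altlt_cmat szu u2 u2' ltu; rewrite cmat_rev21 cmat_rev11.
  by rewrite ltn_mul2l => /andP[].
have ltu' : altlt (rev u) u by rewrite (altltN szu nu) ltu.
have := altlt_cmat (esym szu) u2' u2 ltu'; rewrite cmat_rev21 cmat_rev11.
by rewrite ltn_mul2l => /andP[].
Qed.

(* With [U], [V] the matrices of [u], [v],
   [tr (U V^T) - tr (U V) = (U_12 - U_21) (V_12 - V_21)]. *)
Lemma synchronizing_continuant u v :
  all (leq 2) u -> all (leq 2) v -> u != rev u -> v != rev v ->
  altlt u (rev u) = altlt v (rev v) ->
  cyclic_continuant_word (u ++ v) < cyclic_continuant_word (u ++ rev v).
Proof.
move=> u2 v2 nu nv uv; have := altlt_rev_cmat u2 nu.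
have := altlt_rev_cmat v2 nv; rewrite uv !cyclic_continuant_trace !cmat_cat.
rewrite cmat_rev /trace2; case: (cmat u) (cmat v) => [[a b] [c d]].
by case=> [[a' b'] [c' d']] /=; case: ifP; nia.
Qed.

Lemma max_continuant_unsync (T : eqType) (f : T -> nat) (x : seq T) :
  (forall a, 2 <= f a) ->
  (forall y, perm_eq y x -> cyclic_continuant_word (map f y) <=
                              cyclic_continuant_word (map f x)) ->
  unsync (map f x).
Proof.
move=> f2 xmax n u v; rewrite -map_rot => e nu nv; apply/negP => /eqP uv.
have all2 (z : seq T) : all (leq 2) (map f z)
  by rewrite all_map; apply/allP => a _ /=; apply: f2.
(* The factors are pulled back along [f], since [xmax] concerns only words over [T]. *)
have eu : map f (take (size u) (rot n x)) = u.
  by rewrite map_take e take_size_cat.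
have ev : map f (drop (size u) (rot n x)) = v.
  by rewrite map_drop e drop_size_cat.
have := synchronizing_continuant _ _ nu nv uv.
rewrite -{1}eu -{1}ev !all2 -e => /(_ isT isT).
rewrite map_rot cyclic_continuant_rot ltnNge -{}eu -{}ev -map_rev -map_cat.
rewrite xmax // perm_sym -(perm_rot n x).
by rewrite -{1}(cat_take_drop (size u) (rot n x)) perm_cat2l perm_sym perm_rev.
Qed.

End ContinuantMatrix.

(** * Passage between words and cyclic words; existence of maximizers *)

Section Transport.
Local Open Scope quotient_scope.
Variables (A : finType) (f : A -> nat).
Implicit Types (w : word A) (p : {ffun A -> nat}).

Lemma word_of_seq (x : seq A) : x != [::] -> exists w : word A, val w = x.
Proof. by move=> x0; exists (Sub x x0). Qed.

Lemma pi_rot n w1 w2 : val w2 = rot n (val w1) ->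
  \pi_(cyclic_word A) w1 = \pi_(cyclic_word A) w2.
Proof. by move=> e; apply/eqmodP/conjugateP; exists n. Qed.

Lemma pi_eq_rot w1 w2 :
  \pi_(cyclic_word A) w1 = \pi_(cyclic_word A) w2 ->
  exists n, val w2 = rot n (val w1).
Proof. by move/eqmodP/conjugateP. Qed.

Lemma dihedral_pi w1 w2 : injective f ->
  dihedral (map f (val w1)) (map f (val w2)) ->
  \pi_(cyclic_word A) w2 = \pi w1 \/ \pi_(cyclic_word A) w2 = crev (\pi w1).
Proof.
move=> finj [n []]; rewrite -?map_rev -map_rot => /(inj_map finj) e.
  by left; rewrite (pi_rot e).
by right; rewrite -pi_crev; apply/esym/pi_rot; exact: e.
Qed.

Lemma crevK : involutive (@crev A).
Proof.
elim/quotW => w; rewrite -!pi_crev; congr (\pi _).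
by apply: val_inj; rewrite /= revK.
Qed.

Lemma parikh_perm (x y : seq A) : (parikh x = parikh y) <-> perm_eq x y.
Proof.
split=> [e|/permP e]; last by apply/ffunP => a; rewrite !ffunE e.
by apply/allP => a _ /=; move/ffunP/(_ a): e; rewrite !ffunE => ->.
Qed.

Lemma pi_class p w :
  cyclic_abelian_class p (\pi_(cyclic_word A) w) <-> parikh (val w) = p.
Proof. by rewrite /cyclic_abelian_class /= pi_cparikh. Qed.

Lemma parikh_surj p : exists x : seq A, parikh x = p.
Proof.
exists (flatten [seq nseq (p a) a | a <- enum A]).
apply/ffunP => a; rewrite ffunE count_flatten -map_comp sumnE big_map.
rewrite (bigD1_seq a) ?mem_enum ?enum_uniq //= count_nseq /= eqxx mul1n.
by rewrite big1 ?addn0 // => b ba; rewrite count_nseq /= (negPf ba).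
Qed.

(** The words with Parikh vector [p] are the finitely many permutations of one of them; they are
    non-empty because [p] is non-zero. *)
Lemma exists_max_continuant p : (exists a, p a != 0) ->
  exists w, parikh (val w) = p /\
    forall w', parikh (val w') = p ->
      cyclic_continuant_word (map f (val w')) <=
      cyclic_continuant_word (map f (val w)).
Proof.
move=> [a pa]; have [x ex] := parikh_surj p.
pose K (y : seq A) := cyclic_continuant_word (map f y).
have exK : exists n, has (fun y => K y == n) (permutations x).
  by exists (K x); apply/hasP; exists x; rewrite ?mem_permutations.
have ubK n : has (fun y => K y == n) (permutations x) ->
    n <= \max_(y <- permutations x) K y.
  by case/hasP => y yx /eqP <-; apply: (leq_bigmax_seq y).
case: (ex_maxnP exK ubK) => n /hasP[y].
rewrite mem_permutations => yx /eqP Ky nmax.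
have ey : parikh y = p by rewrite -ex; apply/parikh_perm.
have y0 : y != [::].
  by apply: contraNneq pa => y0; rewrite -ey y0 ffunE.
exists (Sub y y0); split=> // w' ew'; rewrite -/(K y) -/(K (val w')) Ky.
apply: nmax; apply/hasP; exists (val w') => //.
by rewrite mem_permutations; apply/parikh_perm; rewrite ew'.
Qed.

Lemma max_word_unsync p w : (forall a, 2 <= f a) -> parikh (val w) = p ->
  (forall w', parikh (val w') = p ->
     cyclic_continuant_word (map f (val w')) <=
     cyclic_continuant_word (map f (val w))) ->
  unsync (map f (val w)).
Proof.
move=> f2 ew wmax; apply: max_continuant_unsync => // s sw.
have s0 : s != [::].
  by rewrite -size_eq0 (perm_size sw) size_eq0 (valP w).
by apply: (wmax (Sub s s0)); rewrite -ew; apply/parikh_perm.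
Qed.

End Transport.

(** * The alternating order and U_alt seen through an order embedding of the alphabet into the
    naturals *)

Section Alternating.
Local Open Scope quotient_scope.
Variables (disp : Order.disp_t) (A : finOrderType disp) (f : A -> nat).
Hypothesis f_lt : forall a b, (f a < f b) = (a < b)%O.

Lemma altcmp_map_cat up s a b x y : a != b ->
  altcmp up (map f (s ++ a :: x)) (map f (s ++ b :: y)) =
  if odd (size s) (+) up then (a < b)%O else (b < a)%O.
Proof.
move=> ab; elim: s up => [|c s IH] up /=.
  rewrite !f_lt; case: (eqVneq (f a) (f b)) => [e|_].
    by move: ab; rewrite Order.TotalTheory.neq_lt -!f_lt e ltnn.
  by case: up; rewrite orbF.
by rewrite ltnn if_same eqxx /= IH addNb addbN.
Qed.

Lemma f_inj : injective f.
Proof.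
move=> a b e; apply/eqP/negPn.
by rewrite Order.TotalTheory.neq_lt -!f_lt e ltnn.
Qed.

Lemma alt_ltP x y : size x = size y ->
  alt_lt x y <-> altlt (map f x) (map f y).
Proof.
move=> sxy; split.
  move=> [_ [s [a [b [x' [y' [-> -> ab]]]]]]].
  by rewrite /altlt altcmp_map_cat // addbT; case: odd.
move=> ltxy; split=> //.
suff [s [a [b [x' [y' [ex ey ab]]]]]] : exists s a b x' y',
    [/\ x = s ++ a :: x', y = s ++ b :: y' & a != b].
  move: ltxy; rewrite /altlt ex ey altcmp_map_cat // addbT => ltab.
  by exists s, a, b, x', y'; split=> //; case: odd ltab.
have {ltxy} : x != y by apply: contraTneq ltxy => ->; rewrite altltxx.
elim: x y sxy => [|a x IH] [|b y] // [sxy].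
case: (eqVneq a b) => [<-|ab _]; last by exists [::], a, b, x, y.
rewrite eqseq_cons eqxx /= => /(IH _ sxy)[s [c [d [x' [y' [-> -> cd]]]]]].
by exists (a :: s), c, d, x', y'.
Qed.

Lemma alt_synchronizingP u v :
  alt_synchronizing u v <->
  altlt (map f u) (rev (map f u)) = altlt (map f v) (rev (map f v)).
Proof.
rewrite /alt_synchronizing !alt_ltP ?size_rev // !map_rev.
by split=> [[uv vu]|->] //; apply/idP/idP.
Qed.

(** Factorizations of the cyclic word are cuts of rotations of [w]; a factor different from its
    reversal is non-empty, hence an element of [word]. *)
Lemma UaltP (C : set (cyclic_word A)) (w : word A) :
  Ualt C (\pi w) <-> C (\pi w) /\ unsync (map f (val w)).
Proof.
have map_rev_neq (x : seq A) : (map f x != rev (map f x)) = (x != rev x).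
  by rewrite -map_rev (inj_eq (inj_map f_inj)).
split=> -[Cw Uw]; split=> //.
  move=> n u v; rewrite -map_rot => e.
  have eu : map f (take (size u) (rot n (val w))) = u.
    by rewrite map_take e take_size_cat.
  have ev : map f (drop (size u) (rot n (val w))) = v.
    by rewrite map_drop e drop_size_cat.
  rewrite -eu -ev !map_rev_neq => nu nv; apply/negP => /eqP uv.
  have u0 : take (size u) (rot n (val w)) != [::] by apply: contraNneq nu => ->.
  have v0 : drop (size u) (rot n (val w)) != [::] by apply: contraNneq nv => ->.
  have [[u' eu'] [v' ev']] := (word_of_seq u0, word_of_seq v0).
  case: (Uw u' v'); rewrite ?eu' ?ev' //; last exact/alt_synchronizingP.
  by apply: (@pi_rot _ n); rewrite /= eu' ev' cat_take_drop.
move=> u v /pi_eq_rot[n /= e] nu nv /alt_synchronizingP/eqP; apply/negP.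
by apply: (Uw n); rewrite ?map_rev_neq // -map_rot -e map_cat.
Qed.

End Alternating.

Theorem proposition3p9 :
  (forall (disp : Order.disp_t) (A : finOrderType disp)
     (p : {ffun A -> nat}),
     (exists a : A, p a != 0) ->
     (Ualt_sym (symmetric_cyclic_abelian_class p) #= `I_1)%card)
  /\
  (forall A : {fset nat},
     (forall a : nat, a \in A -> 2 <= a) ->
     forall p : {ffun A -> nat},
     (exists a : A, p a != 0) ->
     exists om : cyclic_word A,
       let is_max (nu : cyclic_word A) :=
         cyclic_abelian_class p nu /\
         (forall nu' : cyclic_word A, cyclic_abelian_class p nu' ->
            cyclic_continuant nu' <= cyclic_continuant nu) in
       is_max om /\
       (forall nu : cyclic_word A, is_max nu -> nu = om \/ nu = crev om)).
Proof.
split.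
  move=> disp A p pn0.
  (* The rank of a letter shifted by 2: an order embedding into {2, 3, ...}, which makes the
     continuant argument available for any alphabet. *)
  pose f (a : A) := #|[pred b | (b < a)%O]|.+2.
  have f_homo a b : (a < b)%O -> f a < f b.
    move=> ab; rewrite /f !ltnS; apply/proper_card/properP; split.
      by apply/fintype.subsetP => c; rewrite !inE => c_lt;
         apply: Order.POrderTheory.lt_trans ab.
    by exists a; rewrite !inE // Order.POrderTheory.ltxx.
  have f_lt a b : (f a < f b) = (a < b)%O.
    apply/idP/idP => [|/f_homo//]; apply: contraTT.
    rewrite -leqNgt -Order.TotalTheory.leNgt Order.POrderTheory.le_eqVlt.
    by case/orP => [/eqP->//|/f_homo/ltnW].
  have [w [pw wmax]] := exists_max_continuant f pn0.
  have Uw : unsync (map f (val w)) by apply: max_word_unsync pw wmax.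
  rewrite /Ualt_sym bigcup_symmetric_class.
  suff -> : (@symm A @` Ualt (cyclic_abelian_class p) =
             [set symm (\pi_(cyclic_word A) w)%qT])%classic by exact: card_set1.
  apply/seteqP; split=> [_ [om Uom <-]|_ ->] /=; last first.
    exists (\pi_(cyclic_word A) w)%qT => //.
    by apply/(UaltP f_lt); split=> //; apply/pi_class.
  elim/quotW: om Uom => w' /(UaltP f_lt)[/pi_class pw' Uw'].
  have : dihedral (map f (val w)) (map f (val w')).
    by apply: unsync_unique => //; apply/perm_map/parikh_perm; rewrite pw'.
  case/(dihedral_pi (f_inj f_lt)) => -> //.
  (* A cyclic word and its reversal give the same symmetric pair. *)
  by rewrite /symm crevK setUC.
move=> A A2 p pn0.
pose f (a : A) := fsval a.
have f2 a : 2 <= f a by apply/A2/fsvalP.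
have [w [pw wmax]] := exists_max_continuant f pn0.
have Uw : unsync (map f (val w)) by apply: max_word_unsync pw wmax.
exists (\pi_(cyclic_word A) w)%qT => is_max; split.
  split; first exact/pi_class.
  elim/quotW => w' /pi_class pw'.
  by rewrite !pi_cyclic_continuant; apply: wmax.
elim/quotW => w' [/pi_class pw' w'max].
(* Any other maximizer is free of synchronizing factorizations too, so uniqueness applies to it. *)
apply: (dihedral_pi (val_inj : injective f)); apply: unsync_unique => //.
  by apply/perm_map/parikh_perm; rewrite pw'.
apply: (max_word_unsync f2 pw') => w2 pw2.
by have := w'max _ ((pi_class p w2).2 pw2); rewrite !pi_cyclic_continuant.
Qed.
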